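(* There exists a substitution $\varrho$ on an infinite compact Hausdorff alphabet $\mathcal{A}$, with an associated geometric substitution given by a strictly positive continuous natural length function $\ell:\mathcal{A}\to(0,\infty)$, such that the inflation factor $\lambda$ of this geometric substitution is a transcendental number, and such that every element $x$ of the subshift $X_\varrho$ gives rise to a Delone set, i.e. the set $\Lambda_x\subset\mathbb{R}$ of left endpoints of the tiles associated with $x$ via $\ell$ is a Delone set in $\mathbb{R}$.
   Context: An alphabet is a compact Hausdorff space $\mathcal{A}$; its elements are letters. $\mathcal{A}^n$ is the set of words of length $n$ with the product topology, $\mathcal{A}^+=\bigcup_{n\ge 1}\mathcal{A}^n$ carries the disjoint union topology, and $\mathcal{A}^*=\mathcal{A}^+\cup\{\text{empty word}\}$. A substitution is a continuous map $\varrho:\mathcal{A}\to\mathcal{A}^+$; it is extended to words by concatenation, so powers $\varrho^k$ make sense. A subword of a finite or bi-infinite word is a finite block of consecutive letters of it. The language $\mathcal{L}(\varrho)$ is the closure in $\mathcal{A}^*$ of the set of all subwords of the words $\varrho^k(c)$, $k\ge 0$, $c\in\mathcal{A}$. The subshift of $\varrho$ is $X_\varrho=\{x\in\mathcal{A}^{\mathbb{Z}} : \text{every finite subword of } x \text{ lies in } \mathcal{L}(\varrho)\}$, with the left shift $\sigma$, $\sigma(x)_n=x_{n+1}$. A strictly positive continuous natural length function for $\varrho$ is a continuous $\ell:\mathcal{A}\to(0,\infty)$ for which there is $\lambda>1$ with $\sum_{b\in\varrho(c)}\ell(b)=\lambda\,\ell(c)$ for all $c\in\mathcal{A}$, the sum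 being over the letters of $\varrho(c)$ counted with multiplicity. Such an $\ell$ turns $\varrho$ into an inflation rule (geometric substitution): the letter $c$ becomes an interval of length $\ell(c)$, and the interval inflated by $\lambda$ is dissected into the intervals of the letters of $\varrho(c)$, in order. The number $\lambda$ is the inflation factor. For $x\in X_\varrho$, put $p_0=0$ and $p_{n+1}=p_n+\ell(x_n)$ for all $n\in\mathbb{Z}$; the tile associated with $x_n$ is $[p_n,p_{n+1}]$, and $\Lambda_x=\{p_n:n\in\mathbb{Z}\}$. A set $\Lambda\subset\mathbb{R}^d$ is a Delone set if it is uniformly discrete (there is $r>0$ such that the balls of radius $r$ centred at the points of $\Lambda$ form a packing) and relatively dense (there is $R>0$ such that the balls of radius $R$ centred at the points of $\Lambda$ cover $\mathbb{R}^d$). *)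

(* Defs.v *)
From HB Require Import structures.
From mathcomp Require Import all_boot all_order all_algebra.
From mathcomp Require Import all_classical all_reals all_analysis.

Set Implicit Arguments.
Unset Strict Implicit.
Unset Printing Implicit Defensive.

Import Order.TTheory GRing.Theory Num.Theory.
Import numFieldNormedType.Exports.

Local Open Scope classical_set_scope.
Local Open Scope ring_scope.

Section Words.
Variable A : topologicalType.

(* The space A^n, with the product topology. *)
Definition nword (n : nat) : topologicalType :=
  prod_topology (fun _ : 'I_n => A).

(* The spaces A^* and A^+, with the disjoint union topology. *)
Definition word : topologicalType := {n : nat & nword n}.
Definition pword : topologicalType := {n : nat & nword n.+1}.

Definition letters (n : nat) (w : nword n) : seq A := [seq w i | i <- enum 'I_n].

Definition word_of_seq (s : seq A) : word :=
  existT nword (size s) (fun i => tnth (in_tuple s) i).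

End Words.

Section Subshift.
Variables (A : topologicalType) (rho : A -> pword A).

Definition subst_letter (c : A) : seq A := letters (projT2 (rho c)).

Definition subst_word (s : seq A) : seq A := flatten [seq subst_letter c | c <- s].

Definition language : set (word A) :=
  closure [set word_of_seq u | u in
    [set u : seq A | exists (k : nat) (c : A), infix u (iter k subst_word [:: c])]].

Definition block (x : int -> A) (m : int) (n : nat) : word A :=
  existT (nword A) n (fun i : 'I_n => x (m + (i : nat)%:Z)).

Definition subshift : set (int -> A) :=
  [set x | forall (m : int) (n : nat), language (block x m n)].

End Subshift.

Section Geometric.
Variable R : realType.

Definition natural_length (A : topologicalType) (rho : A -> pword A)
    (l : A -> R) (lambda : R) : Prop :=
  [/\ continuous l,
      forall c, 0 < l c,
      1 < lambda &
      forall c, \sum_(b <- subst_letter rho c) l b = lambda * l c].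

(* The two-sided sequence p determined by p 0 = 0 and
   p (n + 1) = p n + l (x n); see [left_endpoint0] and [left_endpointS]. *)
Definition left_endpoint (A : topologicalType) (l : A -> R) (x : int -> A)
    (n : int) : R :=
  match n with
  | Posz m => \sum_(i < m) l (x (i : nat)%:Z)
  | Negz m => - \sum_(i < m.+1) l (x (Negz i))
  end.

Lemma left_endpoint0 (A : topologicalType) (l : A -> R) (x : int -> A) :
  left_endpoint l x 0 = 0.
Proof. by rewrite /left_endpoint /= big_ord0. Qed.

Lemma left_endpointS (A : topologicalType) (l : A -> R) (x : int -> A) (n : int) :
  left_endpoint l x (n + 1) = left_endpoint l x n + l (x n).
Proof.
case: n => [m|m].
  by rewrite -PoszD addn1 /left_endpoint big_ord_recr.
have -> : Negz m + 1 = - m%:Z by rewrite NegzE -addn1 PoszD opprD addrNK.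
rewrite {2}/left_endpoint big_ord_recr /= opprD addrNK.
case: m => [|m]; first by rewrite oppr0 left_endpoint0 big_ord0 oppr0.
by rewrite -NegzE.
Qed.

Definition left_endpoints (A : topologicalType) (l : A -> R) (x : int -> A) : set R :=
  range (left_endpoint l x).

Definition uniformly_discrete (V : pseudoMetricType R) (L : set V) : Prop :=
  exists2 r : R, 0 < r & trivIset L (fun p => ball p r).

Definition relatively_dense (V : pseudoMetricType R) (L : set V) : Prop :=
  exists2 r : R, 0 < r & \bigcup_(p in L) ball p r = [set: V].

Definition delone (V : pseudoMetricType R) (L : set V) : Prop :=
  uniformly_discrete L /\ relatively_dense L.

Definition transcendental (z : R) : Prop :=
  ~ algebraicOver (ratr : rat -> R) z.

End Geometric.

(* Main.v *)
Require Import Defs.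
From mathcomp Require Import all_boot all_order all_algebra.
From mathcomp Require Import all_classical all_reals all_analysis.
From mathcomp Require Import lra.

Import Order.TTheory GRing.Theory Num.Theory.
Import numFieldNormedType.Exports.
Local Open Scope classical_set_scope.
Local Open Scope ring_scope.

(** Cutting an interval into equal pieces realises every inflation factor
[lam] in the interval [2, 8/3], transcendental ones included. Inflate an
interval of length [s] in [1, 2] by [lam]; if [s] is small cut the result into
two equal pieces, if [s] is large cut it into three. With the threshold 3/2
the pieces again have length in [1, 2] ([greedy_orbit_in]), so the procedure
can be repeated forever.

Taking the length alone as the letter does not work: the number of pieces
jumps at the threshold, so the substitution would be discontinuous there. A
letter therefore also records all future choices. Concretely, the alphabet is
the set of sequences [t] in [1, 2] such that [lam * t n] is twice or three
times [t n.+1], a closed subset of a product of compact intervals, hence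
compact Hausdorff. The substitution sends [t] to two or three copies of the
shifted sequence, and [t 0] is the length of the letter [t]. Whether
[lam * t 0] is [2 * t 1] or [3 * t 1] is a clopen alternative because [t 1]
stays away from 0, which makes the substitution continuous; and the
natural length equation with factor [lam] is the defining relation between
[t 0] and [t 1]. The alphabet is infinite since every length in [1, 2] starts
such a sequence.

A transcendental [lam] exists because algebraic numbers are countable and a
nondegenerate interval is not ([transcendental_itv]). Finally, all tile lengths
lie in [1, 2], and any bi-infinite sequence of tiles whose lengths are bounded
away from 0 and from infinity has a Delone set of endpoints
([left_endpoints_delone]). *)

(** * Transcendental numbers in an interval *)

Lemma finite_roots (F : fieldType) (q : {poly F}) :
  q != 0 -> finite_set [set x | root q x].
Proof.
move=> q0; apply: contrapT => /(infinite_set_fset (size q)) [B Bq].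
apply/negP; rewrite -ltnNge; apply: max_poly_roots => //.
  by apply/allP => x /Bq.
exact: finmap.fset_uniq.
Qed.

Lemma countable_algebraic (R : realType) :
  countable [set x : R | algebraicOver (ratr : rat -> R) x].
Proof.
rewrite (_ : mkset _ = \bigcup_(p in [set p : {poly rat} | p != 0])
    [set x : R | root (map_poly ratr p) x]); last first.
  by apply/seteqP; split=> x [p p0 px]; exists p.
apply: bigcup_countable => [|p /= p0]; first exact: countableP.
by apply/finite_set_countable/finite_roots; rewrite map_poly_eq0.
Qed.

(** A countable set has Lebesgue measure 0, an interval has its length. *)
Lemma uncountable_itv (R : realType) (a b : R) : a < b -> ~ countable `[a, b].
Proof.
move=> ab /countable_lebesgue_measure0; apply/eqP.
by rewrite lebesgue_measure_itv/= lte_fin ab -EFinB eqe subr_eq0 gt_eqF.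
Qed.

Lemma transcendental_itv (R : realType) (a b : R) : a < b ->
  exists2 z, a <= z <= b & transcendental z.
Proof.
move=> ab; apply: contrapT => noz; apply: (uncountable_itv _ _ _ ab).
apply: sub_countable (countable_algebraic R); apply: subset_card_le => z.
rewrite /= in_itv/= => abz; apply: contrapT => zt; by apply: noz; exists z.
Qed.

(** * Delone sets from sequences with bounded steps *)

Section Steps.
Context {R : realType} (p : int -> R) (m M : R).
Hypothesis step_ge : forall n, m <= p (n + 1) - p n.

Lemma steps_ge (n : int) (k : nat) : m *+ k <= p (n + k%:Z) - p n.
Proof.
elim: k => [|k IH]; first by rewrite addr0 subrr.
have := step_ge (n + k%:Z); rewrite -addrA -PoszD addn1 mulrS; lra.
Qed.

(** The values grow at least linearly in both directions, so some value lies
below [y] and some later value above it; the first one above [y] ends the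
bracket. *)
Lemma steps_bracket (y : R) : 0 < m -> exists n, p n <= y < p (n + 1).
Proof.
move=> m0.
have hi (z : R) : exists k : nat, z < m *+ k.
  exists (Num.truncn (`|z| / m)).+1.
  rewrite -mulr_natl -ltr_pdivrMr//; apply: le_lt_trans (truncnS_gt _).
  by rewrite ler_pM2r ?invr_gt0// ler_norm.
(* [p (- i)] lies below [y] and [p j] above it. *)
have [i py] := hi (p 0 - y); have [j yp] := hi (y - p 0).
have lo_i := steps_ge (- i%:Z) i; rewrite addNr in lo_i.
have lo_j := steps_ge 0 j; rewrite add0r in lo_j.
have ex : exists k : nat, y < p (- i%:Z + k%:Z).
  by exists (i + j)%N; rewrite PoszD addKr; lra.
case: (ex_minnP ex) => -[|k] yk mink; first by rewrite addr0 in yk; lra.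
exists (- i%:Z + k%:Z); rewrite -addrA -PoszD addn1 yk andbT leNgt.
by apply/negP => /mink; rewrite ltnn.
Qed.

(** Distinct values are at least [m] apart, so balls of radius [m / 2] are
disjoint; every gap is at most [M], so balls of radius [M] cover. *)
Lemma delone_steps : 0 < m -> (forall n, p (n + 1) - p n <= M) ->
  delone (range p).
Proof.
move=> m0 step_le; split.
  exists (m / 2); first lra.
  have far i j : i < j -> m <= p j - p i.
    move=> ij; have ji : 0 < j - i by rewrite subr_gt0.
    have := steps_ge i `|j - i|%N.
    rewrite (gez0_abs (ltW ji)) subrKC; apply: le_trans.
    by rewrite -[leLHS]mulr1n ler_wpMn2l ?(ltW m0)// absz_gt0 gt_eqF.
  move=> _ _ [i _ <-] [j _ <-] [z []] /=.
  rewrite -!ball_normE/= !ltr_norml => /andP[? ?] /andP[? ?].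
  by case: (ltgtP i j) => [/far|/far|->//]; lra.
exists M; first by have := step_le 0; have := step_ge 0; lra.
rewrite -subTset => y _; have [n /andP[ny yn]] := steps_bracket y m0.
exists (p n); first by exists n.
rewrite -ball_normE/= ltr_norml; have := step_le n; have := step_ge n.
by move=> ? ?; apply/andP; split; lra.
Qed.

End Steps.

Lemma left_endpoints_delone (R : realType) (A : topologicalType) (l : A -> R)
  (x : int -> A) (m M : R) : 0 < m -> (forall c, m <= l c <= M) ->
  delone (left_endpoints l x).
Proof.
move=> m0 lmM; apply: (delone_steps (left_endpoint l x) m M) => // n;
  by rewrite left_endpointS addrC addKr; case/andP: (lmM (x n)).
Qed.

(** * Compact subsets as spaces, and continuity into words *)

Lemma compact_setT_set_type (X : topologicalType) (K : set X) :
  compact K -> compact [set: K].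
Proof.
move=> cK F FF _; have KF : F (set_val @^-1` K).
  by apply: filterS (filterT : F setT) => a _; exact: set_valP.
have [x [Kx clx]] := cK _ (fmap_proper_filter _ FF) KF.
exists (SigSub (mem_set Kx)); split=> // B U FB [_ /= [[V oV <-] Vx] VU].
have imB : F (set_val @^-1` (set_val @` B)).
  by apply: filterS FB => b Bb; exists b.
have nV : nbhs x V by apply: open_nbhs_nbhs; split.
have [_ [[b Bb <-] Vb]] := clx _ _ imB nV.
by exists b; split=> //; apply: VU.
Qed.

Lemma hausdorff_injective (X Y : topologicalType) (f : X -> Y) :
  continuous f -> injective f -> hausdorff_space Y -> hausdorff_space X.
Proof.
move=> cf inj_f hY x y xy; apply/inj_f/hY => U V Ux Vy.
by have [z [Uz Vz]] := xy _ _ (cf _ _ Ux) (cf _ _ Vy); exists (f z).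
Qed.

Lemma continuous_prod_topology {X : topologicalType} {I : eqType}
    {T : I -> topologicalType} (f : X -> prod_topology T) :
  (forall i, continuous (fun x => f x i)) -> continuous f.
Proof.
move=> cf x; apply/cvg_sup => i.
by move=> U [_ [[V oV <-] Vfx]] /filterS; apply; apply: cf; exact: open_nbhs_nbhs.
Qed.

(** Words of different lengths lie in different components of the space of
words, so a letterwise continuous map into words is continuous as soon as the
length is locally constant. The exponent is [(d a).+1], the word being
nonempty. *)
Lemma continuous_locally_constant_power (A : topologicalType)
    (d : A -> nat) (f : A -> A) :
  (forall a, \forall b \near a, d b = d a) -> continuous f ->
  continuous (fun a => existT (fun n => nword A n.+1) (d a) (fun=> f a)
                       : pword A).
Proof.
move=> cd cf a.
have : (fun b => existT (fun n => nword A n.+1) (d a) (fun=> f b) : pword A) @ a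
    --> (existT (fun n => nword A n.+1) (d a) (fun=> f a) : pword A).
  apply: (@cvg_comp _ _ _ (fun b => (fun=> f b) : nword A (d a).+1)
    (existT (fun n => nword A n.+1) (d a))); last exact: existT_continuous.
  exact: continuous_prod_topology.
apply: cvg_trans; apply: near_eq_cvg.
by apply: filterS (cd a) => b /= ->.
Qed.

(** * The alphabet and its substitution *)

(** The sequence [t] lists the successive tile lengths when one keeps inflating
by [lam] and passing to one of the two or three equal pieces. *)
Definition inflation_orbits {R : realType} (lam : R) :
    set (prod_topology (fun _ : nat => R)) :=
  [set t | (forall n, t n \in `[1, 2]) /\
           (forall n, lam * t n = 2 * t n.+1 \/ lam * t n = 3 * t n.+1)].

Section Substitution.
Context {R : realType} (lam : R).
Let T := prod_topology (fun _ : nat => R).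
Let K : set T := inflation_orbits lam.

Let coord_continuous n : continuous (fun t : T => t n).
Proof. exact: (@proj_continuous nat (fun=> R)). Qed.

(** Tychonoff, once the alternative between the factors 2 and 3 is written as
the vanishing of a continuous function. *)
Lemma inflation_orbits_compact : compact K.
Proof.
pose E n (t : T) := (lam * t n - 2 * t n.+1) * (lam * t n - 3 * t n.+1).
rewrite (_ : K = [set t : T | forall n, `[1, 2]%classic (t n)] `&`
    \bigcap_n (E n @^-1` [set x | x = 0])).
  apply: compact_closedI.
    exact (@tychonoff nat (fun=> R) (fun=> `[1, 2]%classic)
      (fun=> @segment_compact R 1 2)).
  apply: closed_bigI => n _; apply: preimage_closed; last exact: closed_eq.
  move=> t _; rewrite /E. apply: (@continuousM R T);
    apply: continuousB; apply: continuousM;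
    exact: cst_continuous || exact: coord_continuous.
rewrite predeqE => t; split=> -[tI tE]; split=> // n.
  by move=> _; rewrite /E/=; case: (tE n) => ->; rewrite subrr ?mul0r ?mulr0.
by have /eqP := tE n I; rewrite mulf_eq0 !subr_eq0 => /orP[]/eqP; [left|right].
Qed.

Lemma inflation_orbits_hausdorff : hausdorff_space K.
Proof.
apply: (hausdorff_injective _ _ set_val).
- exact: initial_continuous.
- exact: val_inj.
- by apply: (@hausdorff_product nat (fun=> R)) => _; exact: Rhausdorff.
Qed.

Definition orbit_head (a : K) : R := set_val a 0%N.

Lemma val_coord_continuous n : continuous (fun a : K => (set_val a : T) n).
Proof.
move=> a; apply: (@continuous_comp _ _ _ set_val (fun t : T => t n)).
  exact: initial_continuous.
exact: coord_continuous.
Qed.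

Lemma tail_subproof (a : K) : (fun n => set_val a n.+1 : R) \in K.
Proof. have [aI aE] := set_valP a; apply/mem_set; split=> n; [exact: aI|exact: aE]. Qed.

Definition orbit_tail (a : K) : K := SigSub (tail_subproof a).

Lemma orbit_tail_continuous : continuous orbit_tail.
Proof.
apply: continuous_comp_initial; apply: continuous_prod_topology => n.
exact: val_coord_continuous.
Qed.

(** One less than the number of pieces. The test separates
[lam * t 0 = 2 * t 1] from [lam * t 0 = 3 * t 1] by the midpoint 5/2: comparing
strictly, rather than testing one of the equalities, makes both outcomes open
conditions on [t]. *)
Definition orbit_extra (a : K) : nat :=
  if lam * set_val a 0%N < 5 / 2 * set_val a 1%N then 1 else 2.

(** The two sides of the test never coincide, since they differ by half of
[t 1], which is at least 1/2; so each outcome persists nearby. *)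
Lemma orbit_extra_locally_constant (a : K) :
  \forall b \near a, orbit_extra b = orbit_extra a.
Proof.
pose g (b : K) : R := lam * set_val b 0%N - 5 / 2 * set_val b 1%N.
have cg : {for a, continuous g}.
  apply: continuousB; apply: continuousM;
    exact: cst_continuous || exact: val_coord_continuous.
have extraE b : orbit_extra b = if g b < 0 then 1%N else 2%N.
  by rewrite /orbit_extra subr_lt0.
have ga0 : g a != 0.
  have sep (x y : R) : 1 <= y -> x = 2 * y \/ x = 3 * y -> x - 5 / 2 * y != 0.
    by move=> y1 [->|->]; apply/eqP => ?; lra.
  have [aI aE] := set_valP a.
  by apply: sep (aE 0%N); have := aI 1%N; rewrite in_itv => /andP[].
rewrite extraE; case: ltgtP ga0 => // ga _.
  apply: filterS (cvgr_lt (g a) cg 0 ga) => b gb.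
  by rewrite extraE gb.
apply: filterS (cvgr_gt (g a) cg 0 ga) => b gb.
by rewrite extraE ltNge ltW.
Qed.

Definition orbit_subst (a : K) : pword K :=
  existT (fun n => nword K n.+1) (orbit_extra a) (fun=> orbit_tail a).

Lemma orbit_subst_continuous : continuous orbit_subst.
Proof.
apply: continuous_locally_constant_power.
  exact: orbit_extra_locally_constant.
exact: orbit_tail_continuous.
Qed.

Lemma orbit_head_itv (a : K) : 1 <= orbit_head a <= 2.
Proof. by have [/(_ 0%N) + _] := set_valP a; rewrite in_itv. Qed.

Lemma orbit_natural_length : 1 < lam -> natural_length orbit_subst orbit_head lam.
Proof.
move=> lam1; split=> //.
- exact: val_coord_continuous.
- by move=> a; case/andP: (orbit_head_itv a) => + _; apply: lt_le_trans.
move=> a; rewrite /subst_letter /letters big_map big_enum/= sumr_const card_ord.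
have [aI aE] := set_valP a.
have powerE (x y : R) : 1 <= y -> x = 2 * y \/ x = 3 * y ->
    y *+ (if x < 5 / 2 * y then 1 else 2).+1 = x.
  by move=> y1 [->|->]; rewrite -mulr_natl; case: ltP => ?; lra.
by apply: powerE (aE 0%N); have := aI 1%N; rewrite in_itv => /andP[].
Qed.

Fixpoint greedy_orbit (s : R) (n : nat) : R :=
  if n is n'.+1 then
    let t := greedy_orbit s n' in
    if t < 3 / 2 then lam / 2 * t else lam / 3 * t
  else s.

(** Halving needs [2 <= lam] for the lower bound 1 and
[lam * (3 / 2) / 2 <= 2], i.e. [lam <= 8 / 3], for the upper bound 2; cutting
into three then also stays within the bounds. *)
Lemma greedy_orbit_in (s : R) :
  2 <= lam <= 8 / 3 -> s \in `[1, 2] -> K (greedy_orbit s).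
Proof.
move=> /andP[lam2 lam83] sI; split; last first.
  by move=> n /=; case: ifP => _; [left|right]; lra.
elim=> [|n]; first exact: sI.
rewrite /= !in_itv/=; set t := greedy_orbit s n => /andP[t1 t2].
by case: ltP => t32; apply/andP; split; nra.
Qed.

(** The first length maps the alphabet onto [1, 2]. *)
Lemma inflation_orbits_infinite : 2 <= lam <= 8 / 3 -> infinite_set [set: K].
Proof.
move=> lamI /(finite_image orbit_head)/finite_set_countable.
suff -> : orbit_head @` setT = `[1, 2]%classic by apply: uncountable_itv; lra.
apply/seteqP; split=> s.
  by move=> [a _ <-]; have := orbit_head_itv a; rewrite /= in_itv.
by move=> sI; exists (SigSub (mem_set (greedy_orbit_in s lamI sI))).
Qed.

End Substitution.

Theorem corollary1p2 (R : realType) :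
  exists (A : topologicalType) (rho : A -> pword A) (l : A -> R) (lambda : R),
    [/\ compact [set: A], hausdorff_space A & infinite_set [set: A]] /\
    [/\ continuous rho,
        natural_length rho l lambda,
        transcendental lambda &
        forall x : int -> A, subshift rho x -> delone (left_endpoints l x)].
Proof.
have [|lam lamI lamT] := transcendental_itv R 2 (8 / 3); first by lra.
exists (inflation_orbits lam), (orbit_subst lam), (orbit_head lam), lam.
split; split=> //.
- exact/compact_setT_set_type/inflation_orbits_compact.
- exact: inflation_orbits_hausdorff.
- exact: inflation_orbits_infinite.
- exact: orbit_subst_continuous.
- by apply: orbit_natural_length; case/andP: lamI; lra.
- move=> x _; apply: (left_endpoints_delone _ _ _ _ 1 2) => //.
  exact: orbit_head_itv.
Qed.
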